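(* For each $r\in\{\downarrow,\uparrow\}$, period addition is not associative: it is not the case that for all dates $D$ and all periods $p_1,p_2$ one has $(D+_r p_1)+_r p_2=D+_r(p_1+p_2)$. That is, there exist a date $D$ and periods $p_1,p_2$ such that $(D+_r p_1)+_r p_2\neq D+_r(p_1+p_2)$.
   Context: Values (dates). A value is either the error element $\bot$ or a triple $(y,m,d)$ of integers (year, month, day; January is month $1$); triples need not denote an existing day. ''Date'' means such a value. For an integer $y$ and $1\le m\le 12$, $\mathrm{nb\_days}(y,m)$ is the number of days of month $m$ of year $y$ in the Gregorian calendar: 31 for $m\in\{1,3,5,7,8,10,12\}$, 30 for $m\in\{4,6,9,11\}$, and for $m=2$: 29 if $y$ is leap, else 28, where $y$ is leap iff ($4\mid y$ and $100\nmid y$) or $400\mid y$. Expressions: $e ::= v \mid e +_\delta n \mid \mathrm{rnd}_r\,e$ with $v$ a value, $n\in\mathbb Z$, $\delta\in\{y,m,d\}$ ($+_y,+_m,+_d$: addition of years, months, days) and rounding mode $r\in\{\uparrow,\downarrow,\bot\}$. The small-step relation $\to$ is the least relation with the following rules, and $\to^*$ is its reflexive-transitive closure. Error rules: $\bot+_\delta n\to\bot$; $\mathrm{rnd}_r\bot\to\bot$; if $m\notin[1,12]$ then $(y,m,d)+_\delta n\to\bot$ and $\mathrm{rnd}_r(y,m,d)\to\bot$. All following rules assume $1\le m\le 12$. Congruence: if $e\to e'$ then $e+_\delta n\to e'+_\delta n$ and $\mathrm{rnd}_r e\to\mathrm{rnd}_r e'$. Years: $(y,m,d)+_y n\to(y+n,m,d)$.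 Months: if $1\le m+n\le 12$, $(y,m,d)+_m n\to(y,m+n,d)$; if $m+n<1$, $(y,m,d)+_m n\to(y-1,m,d)+_m(n+12)$; if $m+n>12$, $(y,m,d)+_m n\to(y+1,m,d)+_m(n-12)$. Days: write $N=\mathrm{nb\_days}(y,m)$. - If $d<1$ or $d>N$: $(y,m,d)+_d n\to\bot$. - If $1\le d\le N$ and $1\le d+n\le N$: $(y,m,d)+_d n\to(y,m,d+n)$. - If $1\le d\le N$ and $d+n>N$: $(y,m,d)+_d n\to((y,m,1)+_m 1)+_d(n-(N-d)-1)$. - If $1<d\le N$ and $d+n\le 0$: $(y,m,d)+_d n\to(y,m,1)+_d(d-1+n)$. - If $n+1\le 0$ and $(y,m,1)+_m(-1)\to^*(y',m',d')$ (a triple): $(y,m,1)+_d n\to(y',m',1)+_d(n+\mathrm{nb\_days}(y',m'))$. Rounding, with $N=\mathrm{nb\_days}(y,m)$: if $d<1$, $\mathrm{rnd}_r(y,m,d)\to\bot$ for every $r$; if $1\le d\le N$, $\mathrm{rnd}_r(y,m,d)\to(y,m,d)$ for every $r$; if $d>N$: $\mathrm{rnd}_\bot(y,m,d)\to\bot$, $\mathrm{rnd}_\downarrow(y,m,d)\to(y,m,N)$, and $\mathrm{rnd}_\uparrow(y,m,d)\to(y',m',1)$ where $(y,m,d)+_m 1\to^*(y',m',d')$ (a triple). A period $p$ consists of three integers: $n_y$ years, $n_m$ months, $n_d$ days; the sum $p_1+p_2$ of periods is componentwise. For an expression $e$ and rounding mode $r$, $e+_r p := \mathrm{rnd}_r\big((e+_y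 n_y)+_m n_m\big)+_d n_d$. Equality of expressions means that they evaluate (via $\to^*$) to the same value. *)

(* Defs.v *)
From Stdlib Require Export ZArith Bool Relation_Operators.

Open Scope Z_scope.

Definition is_leap (y : Z) : bool :=
  ((y mod 4 =? 0) && negb (y mod 100 =? 0)) || (y mod 400 =? 0).

(* Only meaningful for [1 <= m <= 12]; the value outside that range is junk. *)
Definition nb_days (y m : Z) : Z :=
  match m with
  | 2 => if is_leap y then 29 else 28
  | 4 | 6 | 9 | 11 => 30
  | _ => 31
  end.

(* A [Triple] is unconstrained: it need not denote an existing day. *)
Inductive value : Type :=
| Bot : value
| Triple (y m d : Z) : value.

Inductive date_unit : Type := Years | Months | Days.

Inductive rounding : Type := RoundUp | RoundDown | RoundErr.

Inductive expr : Type :=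
| Val (v : value) : expr
| Add (u : date_unit) (e : expr) (n : Z) : expr
| Rnd (r : rounding) (e : expr) : expr.

Notation date y m d := (Val (Triple y m d)).

Definition valid_month (m : Z) : Prop := 1 <= m <= 12.

(* Two rules have a premise about the reflexive-transitive closure of the
   relation being defined, hence the nested use of [clos_refl_trans]. *)
Inductive step : expr -> expr -> Prop :=
| step_add_bot u n :
    step (Add u (Val Bot) n) (Val Bot)
| step_rnd_bot r :
    step (Rnd r (Val Bot)) (Val Bot)
| step_add_bad_month u y m d n :
    ~ valid_month m ->
    step (Add u (date y m d) n) (Val Bot)
| step_rnd_bad_month r y m d :
    ~ valid_month m ->
    step (Rnd r (date y m d)) (Val Bot)
| step_add_congr u e e' n :
    step e e' ->
    step (Add u e n) (Add u e' n)
| step_rnd_congr r e e' :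
    step e e' ->
    step (Rnd r e) (Rnd r e')
| step_years y m d n :
    valid_month m ->
    step (Add Years (date y m d) n) (date (y + n) m d)
| step_months y m d n :
    valid_month m ->
    1 <= m + n <= 12 ->
    step (Add Months (date y m d) n) (date y (m + n) d)
| step_months_under y m d n :
    valid_month m ->
    m + n < 1 ->
    step (Add Months (date y m d) n) (Add Months (date (y - 1) m d) (n + 12))
| step_months_over y m d n :
    valid_month m ->
    m + n > 12 ->
    step (Add Months (date y m d) n) (Add Months (date (y + 1) m d) (n - 12))
| step_days_bad_day y m d n :
    valid_month m ->
    d < 1 \/ d > nb_days y m ->
    step (Add Days (date y m d) n) (Val Bot)
| step_days y m d n :
    valid_month m ->
    1 <= d <= nb_days y m ->
    1 <= d + n <= nb_days y m ->
    step (Add Days (date y m d) n) (date y m (d + n))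
| step_days_over y m d n :
    valid_month m ->
    1 <= d <= nb_days y m ->
    d + n > nb_days y m ->
    step (Add Days (date y m d) n)
         (Add Days (Add Months (date y m 1) 1) (n - (nb_days y m - d) - 1))
| step_days_under y m d n :
    valid_month m ->
    1 < d <= nb_days y m ->
    d + n <= 0 ->
    step (Add Days (date y m d) n) (Add Days (date y m 1) (d - 1 + n))
| step_days_under_first y m n y' m' d' :
    valid_month m ->
    n + 1 <= 0 ->
    clos_refl_trans expr step (Add Months (date y m 1) (-1)) (date y' m' d') ->
    step (Add Days (date y m 1) n) (Add Days (date y' m' 1) (n + nb_days y' m'))
| step_rnd_neg r y m d :
    valid_month m ->
    d < 1 ->
    step (Rnd r (date y m d)) (Val Bot)
| step_rnd_ok r y m d :
    valid_month m ->
    1 <= d <= nb_days y m ->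
    step (Rnd r (date y m d)) (date y m d)
| step_rnd_err y m d :
    valid_month m ->
    d > nb_days y m ->
    step (Rnd RoundErr (date y m d)) (Val Bot)
| step_rnd_down y m d :
    valid_month m ->
    d > nb_days y m ->
    step (Rnd RoundDown (date y m d)) (date y m (nb_days y m))
| step_rnd_up y m d y' m' d' :
    valid_month m ->
    d > nb_days y m ->
    clos_refl_trans expr step (Add Months (date y m d) 1) (date y' m' d') ->
    step (Rnd RoundUp (date y m d)) (date y' m' 1).

Definition steps : expr -> expr -> Prop := clos_refl_trans expr step.

Definition expr_eq (e1 e2 : expr) : Prop :=
  exists v : value, steps e1 (Val v) /\ steps e2 (Val v).

Record period : Type := Period { nyears : Z; nmonths : Z; ndays : Z }.

Definition period_add (p1 p2 : period) : period :=
  Period (nyears p1 + nyears p2) (nmonths p1 + nmonths p2) (ndays p1 + ndays p2).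

Definition add_period (r : rounding) (e : expr) (p : period) : expr :=
  Add Days (Rnd r (Add Months (Add Years e (nyears p)) (nmonths p))) (ndays p).

(* Main.v *)
Require Import Defs.
From Stdlib Require Import Lia Operators_Properties.

(** Rounding loses the day of the month at the intermediate date. Starting from
    31 January 2001 and adding one month twice passes through the non-existing
    31 February: rounding down gives 28 February and then 28 March, rounding up
    gives 1 March and then 1 April, whereas adding two months at once gives
    31 March for both modes. That these results are really different as
    expressions follows from the determinism of the reduction relation. *)

Lemma val_normal v e : ~ step (Val v) e.
Proof. intros H; inversion H. Qed.

(** Values are normal, so two reductions to values can be matched step by step. The invariant [P]
    lets the argument serve twice: for month additions alone, then for all expressions. *)
Lemma steps_value_unique (P : expr -> Prop)
  (closed : forall e e', P e -> step e e' -> P e')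
  (det : forall e e1 e2, P e -> step e e1 -> step e e2 -> e1 = e2)
  e v1 v2 :
  P e -> steps e (Val v1) -> steps e (Val v2) -> v1 = v2.
Proof.
  intros He H1; revert He.
  apply clos_rt_rt1n in H1; remember (Val v1) as w eqn:Ew.
  induction H1 as [e | e e' w He' _ IH]; intros He H2;
    apply clos_rt_rt1n in H2; inversion H2 as [Ee | e'' w' He'' Hrest]; subst.
  - congruence.
  - now apply val_normal in He''.
  - now apply val_normal in He'.
  - rewrite <- (det _ _ _ He He' He'') in Hrest.
    apply IH; [reflexivity | now apply (closed e) | now apply clos_rt1n_rt].
Qed.

(* Two rules for days and rounding have a month addition to a date as premise,
   so determinism has to be established for these expressions first. *)
Inductive months_form : expr -> Prop :=
| months_form_val v : months_form (Val v)
| months_form_add v n : months_form (Add Months (Val v) n).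

Ltac refute_val_step :=
  match goal with
  | H : step (Val _) _ |- _ => now apply val_normal in H
  end.

Lemma months_form_step e e' : months_form e -> step e e' -> months_form e'.
Proof.
  intros [v | v n] H; inversion H; subst; try refute_val_step; constructor.
Qed.

Lemma months_form_deterministic e e1 e2 :
  months_form e -> step e e1 -> step e e2 -> e1 = e2.
Proof.
  intros [v | v n] H1 H2; inversion H1; subst; try refute_val_step;
    inversion H2; subst; try refute_val_step;
    solve [reflexivity | contradiction | lia].
Qed.

Lemma add_months_unique y m d n v1 v2 :
  steps (Add Months (date y m d) n) (Val v1) ->
  steps (Add Months (date y m d) n) (Val v2) -> v1 = v2.
Proof.
  apply (steps_value_unique months_form);
    [exact months_form_step | exact months_form_deterministic | constructor].
Qed.

(** Ensures that day 1 always exists, which separates [step_days_under_first] from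
    [step_days_bad_day]. *)
Lemma nb_days_ge_28 y m : 28 <= nb_days y m.
Proof.
  unfold nb_days; destruct (is_leap y);
    repeat match goal with |- context [match ?x with _ => _ end] => destruct x end;
    lia.
Qed.

(** The guards of the rules are mutually exclusive, and congruence cannot compete with them because
    values are normal. *)
Lemma step_deterministic e e1 e2 : step e e1 -> step e e2 -> e1 = e2.
Proof.
  intros H1; revert e2; induction H1; intros e2 H2; inversion H2; subst;
    try refute_val_step;
    try solve [reflexivity | contradiction | lia | f_equal; auto
              | pose proof (nb_days_ge_28 y m); lia];
    (* Left are [step_days_under_first] and [step_rnd_up], each against itself: the target depends
       on the triple reached in the premise. *)
    match goal with
    | Ha : clos_refl_trans _ _ (Add Months _ _) _,
      Hb : clos_refl_trans _ _ (Add Months _ _) _ |- _ =>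
        pose proof (add_months_unique _ _ _ _ _ _ Ha Hb); congruence
    end.
Qed.

Lemma steps_unique e v1 v2 : steps e (Val v1) -> steps e (Val v2) -> v1 = v2.
Proof.
  apply (steps_value_unique (fun _ => True)); trivial.
  intros ? ? ? _; apply step_deterministic.
Qed.

Lemma steps_add u e e' n : steps e e' -> steps (Add u e n) (Add u e' n).
Proof.
  induction 1 as [| | ? e']; [| apply rt_refl | now apply rt_trans with (Add u e' n)].
  now apply rt_step, step_add_congr.
Qed.

Lemma steps_rnd r e e' : steps e e' -> steps (Rnd r e) (Rnd r e').
Proof.
  induction 1 as [| | ? e']; [| apply rt_refl | now apply rt_trans with (Rnd r e')].
  now apply rt_step, step_rnd_congr.
Qed.

(** Only the rounding depends on [r], so it stays a hypothesis; a general [e] allows chaining two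
    periods. Even adding 0 days fails on a non-existing day, hence the bounds on [d']. *)
Lemma add_months_steps r e y m d n d' y' m' :
  steps e (date y m d) ->
  valid_month m -> 1 <= m + n <= 12 ->
  steps (Rnd r (date y (m + n) d)) (date y' m' d') ->
  valid_month m' -> 1 <= d' <= nb_days y' m' ->
  steps (add_period r e (Period 0 n 0)) (date y' m' d').
Proof.
  intros He Hm Hn Hr Hm' Hd'; unfold add_period; simpl.
  apply rt_trans with (Add Days (date y' m' d') 0).
  - apply steps_add.
    apply rt_trans with (Rnd r (date y (m + n) d)); [apply steps_rnd | exact Hr].
    apply rt_trans with (Add Months (date y m d) n).
    + apply steps_add, rt_trans with (Add Years (date y m d) 0).
      * now apply steps_add.
      * rewrite <- (Z.add_0_r y) at 2; now apply rt_step, step_years.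
    + now apply rt_step, step_months.
  - rewrite <- (Z.add_0_r d') at 2; apply rt_step, step_days; trivial; lia.
Qed.

Lemma steps_distinct_not_expr_eq e1 e2 v1 v2 :
  steps e1 (Val v1) -> steps e2 (Val v2) -> v1 <> v2 -> ~ expr_eq e1 e2.
Proof.
  intros H1 H2 Hne [v [H1' H2']]; apply Hne.
  now rewrite (steps_unique _ _ _ H1 H1'), (steps_unique _ _ _ H2 H2').
Qed.

(** 31 March exists, so every mode leaves it unchanged. *)
Lemma two_months_at_once r :
  steps (add_period r (date 2001 1 31) (Period 0 2 0)) (date 2001 3 31).
Proof.
  apply add_months_steps with 2001 1 31; try (unfold valid_month; simpl; lia).
  - apply rt_refl.
  - apply rt_step, step_rnd_ok; unfold valid_month; simpl; lia.
Qed.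

Lemma month_by_month_down :
  steps (add_period RoundDown
           (add_period RoundDown (date 2001 1 31) (Period 0 1 0)) (Period 0 1 0))
        (date 2001 3 28).
Proof.
  apply add_months_steps with 2001 2 28; try (unfold valid_month; simpl; lia).
  - apply add_months_steps with 2001 1 31; try (unfold valid_month; cbn; lia).
    + apply rt_refl.
    (* 2001 is not a leap year, so [nb_days 2001 2] computes to 28. *)
    + apply rt_step, (step_rnd_down 2001 2 31); unfold valid_month; cbn; lia.
  - apply rt_step, step_rnd_ok; unfold valid_month; simpl; lia.
Qed.

Lemma month_by_month_up :
  steps (add_period RoundUp
           (add_period RoundUp (date 2001 1 31) (Period 0 1 0)) (Period 0 1 0))
        (date 2001 4 1).
Proof.
  apply add_months_steps with 2001 3 1; try (unfold valid_month; simpl; lia).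
  - apply add_months_steps with 2001 1 31; try (unfold valid_month; simpl; lia).
    + apply rt_refl.
    (* 31 is the day carried along to March in the premise; rounding up replaces it by 1. *)
    + apply rt_step, step_rnd_up with 31; try (unfold valid_month; cbn; lia).
      apply rt_step, (step_months 2001 2 31 1); unfold valid_month; lia.
  - apply rt_step, step_rnd_ok; unfold valid_month; simpl; lia.
Qed.

Theorem mainTheorem7 (r : rounding) (hr : r = RoundDown \/ r = RoundUp) :
  ~ (forall (D : value) (p1 p2 : period),
       expr_eq (add_period r (add_period r (Val D) p1) p2)
               (add_period r (Val D) (period_add p1 p2))) /\
  (exists (D : value) (p1 p2 : period),
     ~ expr_eq (add_period r (add_period r (Val D) p1) p2)
               (add_period r (Val D) (period_add p1 p2))).
Proof.
  assert (Hne : ~ expr_eq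
    (add_period r (add_period r (date 2001 1 31) (Period 0 1 0)) (Period 0 1 0))
    (add_period r (date 2001 1 31) (period_add (Period 0 1 0) (Period 0 1 0)))).
  { destruct hr as [-> | ->]; eapply steps_distinct_not_expr_eq.
    - exact month_by_month_down.
    - exact (two_months_at_once _).
    - discriminate.
    - exact month_by_month_up.
    - exact (two_months_at_once _).
    - discriminate. }
  split.
  - intros H; exact (Hne (H _ _ _)).
  - now exists (Triple 2001 1 31), (Period 0 1 0), (Period 0 1 0).
Qed.
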